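(* Let $n\ge3$ and let $\mathcal M=(G,\mathit{In},\mathit{Out},\mathit{Leak})$ be the $n$-compartment directed-cycle model with $\mathit{In}=\mathit{Out}=\{1\}$ and $\mathit{Leak}=\{\ell\}$, where $1\le\ell\le n$. For $i\in\{1,\dots,n\}$ set $\widetilde k_i:=k_{i+1,i}$ if $i\ne\ell$ and $\widetilde k_\ell:=k_{\ell+1,\ell}+k_{0\ell}$ (with $k_{n+1,n}:=k_{1n}$). Then the singular locus of $\mathcal M$ is the zero set of $$\prod_{i\in\{1,\dots,n\}\setminus\{\ell\}}k_{i+1,i}\ \prod_{2\le i<j\le n}(\widetilde k_i-\widetilde k_j).$$
   Context: A linear compartmental model $\mathcal M=(G,\mathit{In},\mathit{Out},\mathit{Leak})$ consists of a finite directed graph $G=(V,E)$ with $V=\{1,\dots,n\}$ and subsets $\mathit{In},\mathit{Out},\mathit{Leak}\subseteq V$. Each edge $j\to i$ carries a parameter $k_{ij}$, each $\ell\in\mathit{Leak}$ a parameter $k_{0\ell}$; parameter space $\mathbb R^{|E|+|\mathit{Leak}|}$. The compartmental matrix $A$ has $a_{ii}=-\sum_{p:\,i\to p\in E}k_{pi}$ (additionally $-k_{0i}$ if $i\in\mathit{Leak}$), $a_{ij}=k_{ij}$ if $j\to i\in E$, $0$ otherwise ($i\ne j$). For $i\in\mathit{Out}$ the input-output equation is $\det(\partial I-A)\,y_i=\sum_{j\in\mathit{In}}(-1)^{i+j}\det[(\partial I-A)^{j,i}]\,u_j$ ($\partial=d/dt$; $B^{j,i}$ deletes row $j$ and column $i$);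 its coefficients are polynomials in the parameters, and the coefficient map $\mathsf c$ is the vector of these coefficients (containing all non-constant ones). For a generically locally identifiable model, the singular locus is the set of parameter vectors in $\mathbb R^{|E|+|\mathit{Leak}|}$ at which the Jacobian matrix of $\mathsf c$ does not have full rank $|E|+|\mathit{Leak}|$. A directed-cycle model has $n\ge3$, $V=\{1,\dots,n\}$, $E=\{1\to2,\dots,(n-1)\to n,n\to1\}$. *)

(* Defs.v *)
From HB Require Import structures.
From mathcomp Require Import all_boot all_order all_algebra.
From mathcomp Require Import reals.
From mathcomp Require Import mpoly.

Set Implicit Arguments.
Unset Strict Implicit.
Unset Printing Implicit Defensive.

Import GRing.Theory Num.Theory.
Local Open Scope ring_scope.

(* Vertex i of V = {1, ..., n} is the ordinal i - 1 : 'I_n, and an edge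
   j -> i is the pair (j, i). *)
Record model (n : nat) := Model {
  edges : {set 'I_n * 'I_n};
  inputs : {set 'I_n};
  outputs : {set 'I_n};
  leaks : {set 'I_n} }.

Section Model.
Variables (R : realType) (n : nat) (M : model n).

Definition nparams : nat := (#|edges M| + #|leaks M|)%N.

(* [kedge i j] is the indeterminate k_{ij} when j -> i is an edge, and
   [kleak l] is k_{0l} when l is a leak: each sum then has exactly one term,
   and it is empty otherwise. *)
Definition kedge (i j : 'I_n) : {mpoly R[nparams]} :=
  \sum_(r < #|edges M| | enum_val r == (j, i)) 'X_(lshift #|leaks M| r).

Definition kleak (l : 'I_n) : {mpoly R[nparams]} :=
  \sum_(r < #|leaks M| | enum_val r == l) 'X_(rshift #|edges M| r).

Definition compartmental_mx : 'M[{mpoly R[nparams]}]_n :=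
  \matrix_(i, j)
    if i == j then
      - (\sum_(p | (i, p) \in edges M) kedge p i)
        - (if i \in leaks M then kleak i else 0)
    else if (j, i) \in edges M then kedge i j else 0.

(* The operator d/dt is the polynomial variable 'X over the ring of
   polynomials in the parameters, so that dI - A is [char_poly_mx A]; the
   coefficient of u_j, namely (-1)^(i+j) det (dI - A)^{j,i}, is the (j, i)
   cofactor of that matrix (shifting both indices by one preserves the sign). *)
Definition io_coef_y : {poly {mpoly R[nparams]}} :=
  \det (char_poly_mx compartmental_mx).

Definition io_coef_u (i j : 'I_n) : {poly {mpoly R[nparams]}} :=
  cofactor (char_poly_mx compartmental_mx) j i.

(* All coefficients of all input-output equations, the constant ones (such as
   the leading 1 of [io_coef_y]) included: they only add zero rows to the
   Jacobian matrix. *)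
Definition coefficient_map : seq {mpoly R[nparams]} :=
  flatten [seq (io_coef_y : seq _) ++
               flatten [seq (io_coef_u i j : seq _) | j <- enum (inputs M)]
          | i <- enum (outputs M)].

Definition jacobian_mx (k : 'rV[R]_nparams) :
    'M[R]_(size coefficient_map, nparams) :=
  \matrix_(r, q) (mderiv q coefficient_map`_r).@[k 0].

Definition singular_locus : {pred 'rV[R]_nparams} :=
  [pred k | \rank (jacobian_mx k) != nparams].

End Model.

Arguments singular_locus R {n} M.

Definition zero_set (R : realType) (m : nat) (p : {mpoly R[m]}) :
    {pred 'rV[R]_m} :=
  [pred k : 'rV[R]_m | p.@[k 0] == 0].

Definition cycle_edges (n : nat) : {set 'I_n * 'I_n} :=
  [set (i, ordS i) | i : 'I_n].

(* Stated by value, so that compartment 1 makes sense for every n; the set is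
   a singleton as soon as n > 0. *)
Definition compartment1 (n : nat) : {set 'I_n} := [set i : 'I_n | val i == 0%N].

Definition cycle_model (n : nat) (l : 'I_n) : model n :=
  Model (cycle_edges n) (compartment1 n) (compartment1 n) [set l].

Definition ktilde (R : realType) (n : nat) (l i : 'I_n) :
    {mpoly R[nparams (cycle_model l)]} :=
  if i == l then kedge R (cycle_model l) (ordS i) i + kleak R (cycle_model l) i
  else kedge R (cycle_model l) (ordS i) i.

(* Main.v *)
(* Write t_i for the modified rate of compartment i.  The input-output equation
   has coefficients Q = prod_(i >= 2) (X + t_i) on the input side and
   P = (X + t_1) Q - prod_i k_{i+1,i} on the output side.  The Jacobian fails to
   have full rank iff some nonzero direction v satisfies D_v P = D_v Q = 0.
   Once D_v Q = 0, D_v P = (D_v t_1) Q - D_v (prod_i k_{i+1,i}) with Q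
   nonconstant, so both derivatives on the right vanish.  If t_2, ..., t_n are
   distinct, evaluating D_v Q at -t_i gives D_v t_i = 0; then v only trades
   k_{l+1,l} against k_{0l}, and D_v (prod_i k_{i+1,i}) is a nonzero multiple
   of prod_(i <> l) k_{i+1,i}.  If t_i = t_j, increasing t_i and decreasing
   t_j kills D_v Q, and k_{l+1,l} remains free to kill the last equation. *)
Require Import Defs.
From HB Require Import structures.
From mathcomp Require Import all_boot all_order all_algebra.
From mathcomp Require Import reals.
From mathcomp Require Import mpoly.

Set Implicit Arguments.
Unset Strict Implicit.
Unset Printing Implicit Defensive.

Import GRing.Theory.
Local Open Scope ring_scope.

(** * Determinant and cofactors of a cyclic bidiagonal matrix *)

Lemma ordS_neq m (i : 'I_m.+2) : ordS i != i.
Proof.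
apply/eqP => /(congr1 val) /= e; have := ltn_ord i.
rewrite leq_eqVlt eqSS => /orP[/eqP ei|lt_i].
  by move: e; rewrite ei modnn.
by move: e; rewrite modn_small // => /eqP; rewrite gtn_eqF.
Qed.

Section CyclicMatrix.
Variables (A : comNzRingType) (m : nat) (d c : 'I_m.+2 -> A).

Definition cyclic_mx : 'M[A]_m.+2 :=
  \matrix_(i, j) if i == j then d i else if i == ordS j then c j else 0.

(** The wrap-around entry lies in row 0; without that row the matrix is lower triangular. *)
Lemma cofactor_cyclic_mx00 :
  cofactor cyclic_mx 0 0 = \prod_(i < m.+2 | (0 < i)%N) d i.
Proof.
rewrite /cofactor addn0 expr0 mul1r det_trig.
  rewrite [RHS]big_mkcond [RHS]big_ord_recl /= mul1r.
  by apply: eq_bigr => i _; rewrite !mxE eqxx.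
apply/is_trig_mxP => i j lt_ij; rewrite !mxE.
rewrite (inj_eq lift_inj) -[i == j]/(val i == val j) ltn_eqF //.
case: eqP => // /(congr1 val) /=; rewrite /bump /= !add1n.
have := ltn_ord j; rewrite leq_eqVlt eqSS => /orP[/eqP ->|lt_j].
  by rewrite modnn.
rewrite modn_small // => - [eij].
by rewrite eij ltnNge leqnSn in lt_ij.
Qed.

(** Deleting row 0 and the last column moves the entries [c] onto the diagonal of an upper
    triangular matrix, hence the transpose. *)
Lemma cofactor_cyclic_mx0max :
  cofactor cyclic_mx 0 ord_max =
  (-1) ^+ m.+1 * \prod_(i < m.+1) c (widen_ord (leqnSn _) i).
Proof.
rewrite /cofactor add0n -det_tr det_trig.
  congr (_ * _); apply: eq_bigr => i _; rewrite !mxE.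
  have -> : lift ord_max i = widen_ord (leqnSn _) i :> 'I_m.+2.
    by apply: val_inj; rewrite /= /bump /= leqNgt ltn_ord.
  have -> : lift 0 i = ordS (widen_ord (leqnSn m.+1) i) :> 'I_m.+2.
    by apply: val_inj; rewrite /= modn_small // ltnS.
  by rewrite (negPf (ordS_neq _)) eqxx.
apply/is_trig_mxP => i j lt_ij; rewrite !mxE -!val_eqE /= /bump /=.
rewrite leqNgt ltn_ord /= add0n add1n gtn_eqF ?(ltn_trans lt_ij) // modn_small.
  by rewrite eqSS gtn_eqF.
by rewrite ltnS; apply: ltn_ord.
Qed.

(** Row 0 has only two possibly nonzero entries, [d 0] and [c ord_max]. *)
Lemma det_cyclic_mx :
  \det cyclic_mx = \prod_i d i + (-1) ^+ m.+1 * \prod_i c i.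
Proof.
rewrite (expand_det_row _ 0) (bigD1 0) //=.
rewrite (bigD1 ord_max) //= big1 ?addr0; last first.
  move=> j /andP[j0 jmax]; rewrite mxE eq_sym (negPf j0).
  case: eqP; last by rewrite mul0r.
  move/(congr1 val) => /=; rewrite modn_small // ltnS ltn_neqAle.
  by rewrite -ltnS ltn_ord andbT.
have e0 : 0 == ordS ord_max :> 'I_m.+2 by rewrite -val_eqE /= modnn.
rewrite cofactor_cyclic_mx00 cofactor_cyclic_mx0max !mxE eqxx e0 /= mulrCA.
congr (_ + _ * _).
  rewrite [RHS](bigD1 0) //=; congr (_ * _).
  by apply: eq_bigl => i; rewrite lt0n.
by rewrite [RHS]big_ord_recr mulrC.
Qed.

End CyclicMatrix.

(** * Directional derivatives with respect to the parameters *)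

Section DirectionalDerivative.
Variables (R : comNzRingType) (N : nat) (k v : 'rV[R]_N).
Implicit Types (p q : {mpoly R[N]}) (P Q : {poly {mpoly R[N]}}).

Definition dderiv p : R := \sum_i v 0 i * (mderiv i p).@[k 0].

Lemma dderiv_is_additive : zmod_morphism dderiv.
Proof.
move=> p q; rewrite -sumrB; apply: eq_bigr => i _.
by rewrite mderivB mevalB mulrBr.
Qed.

HB.instance Definition _ :=
  GRing.isZmodMorphism.Build {mpoly R[N]} R dderiv dderiv_is_additive.

Lemma dderivM p q : dderiv (p * q) = dderiv p * q.@[k 0] + p.@[k 0] * dderiv q.
Proof.
rewrite mulr_suml mulr_sumr -big_split; apply: eq_bigr => i _ /=.
by rewrite mderivM mevalD !mevalM mulrDr mulrA mulrCA.
Qed.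

Lemma dderiv1 : dderiv 1 = 0.
Proof. by apply: big1 => i _; rewrite -mpolyC1 mderivC meval0 mulr0. Qed.

Lemma dderivX i : dderiv 'X_i = v 0 i.
Proof.
rewrite /dderiv (bigD1 i) //= big1 ?addr0 => [|j ji].
  rewrite mderivX mnmE eqxx scale1r -[X in (X - _)%MM]add0m addmK.
  by rewrite mpolyX0 meval1 mulr1.
by rewrite mderivX mnmE eq_sym (negPf ji) scale0r meval0 mulr0.
Qed.

(** Taken coefficientwise, so that one equation in [{poly R}] expresses that every coefficient is
    stationary along [v]. *)
Definition dderivp P : {poly R} := map_poly dderiv P.

Lemma coef_dderivp P i : (dderivp P)`_i = dderiv P`_i.
Proof. by rewrite coef_map_id0 ?raddf0. Qed.

Lemma dderivpB P Q : dderivp (P - Q) = dderivp P - dderivp Q.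
Proof. by apply/polyP => i; rewrite coefB !coef_dderivp coefB raddfB. Qed.

Lemma dderivpM P Q :
  dderivp (P * Q) =
  dderivp P * map_poly (meval (k 0)) Q + map_poly (meval (k 0)) P * dderivp Q.
Proof.
apply/polyP => i; rewrite coefD !coefM coef_dderivp coefM raddf_sum -big_split.
by apply: eq_bigr => j _; rewrite !coef_dderivp !coef_map /= dderivM.
Qed.

Lemma dderivpC p : dderivp p%:P = (dderiv p)%:P.
Proof.
apply/polyP => i; rewrite coef_dderivp !coefC.
by case: eqP => // _; rewrite raddf0.
Qed.

Lemma dderivpXDC p : dderivp ('X + p%:P) = (dderiv p)%:P.
Proof.
apply/polyP => i; rewrite coef_dderivp coefD coefX raddfD !coefC /=.
case: (i == 1)%N; rewrite /= ?dderiv1 ?raddf0 add0r.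
all: by case: eqP; rewrite ?raddf0.
Qed.

Lemma dderivp_prod_eq0 (I : finType) (S : pred I)
    (F : I -> {poly {mpoly R[N]}}) :
  (forall i, S i -> dderivp (F i) = 0) -> dderivp (\prod_(i | S i) F i) = 0.
Proof.
move=> F0; elim/big_ind: _ => //.
  by rewrite -polyC1 dderivpC dderiv1.
by move=> P Q P0 Q0; rewrite dderivpM P0 Q0 mul0r mulr0 addr0.
Qed.

Lemma meval_XDC p :
  map_poly (meval (k 0)) ('X + p%:P) = 'X + (p.@[k 0])%:P.
Proof. by rewrite rmorphD /= map_polyX map_polyC. Qed.

Lemma meval_prodXDC (I : finType) (S : pred I) (t : I -> {mpoly R[N]}) :
  map_poly (meval (k 0)) (\prod_(i | S i) ('X + (t i)%:P)) =
  \prod_(i | S i) ('X + ((t i).@[k 0])%:P).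
Proof.
by rewrite rmorph_prod; apply: eq_bigr => i _; apply: meval_XDC.
Qed.

Lemma dderivp_mul_eq0 P Q :
  map_poly (meval (k 0)) P = map_poly (meval (k 0)) Q ->
  dderivp P + dderivp Q = 0 -> dderivp (P * Q) = 0.
Proof. by move=> ePQ D0; rewrite dderivpM ePQ mulrC -mulrDr D0 mulr0. Qed.

(* Explicit terms, because rewriting with [dderivpXDC] tries to unify the two
   factors and unfolds polynomial addition. *)
Lemma dderivp_mulXDC_eq0 p q :
  p.@[k 0] = q.@[k 0] -> dderiv p + dderiv q = 0 ->
  dderivp (('X + p%:P) * ('X + q%:P)) = 0.
Proof.
move=> epq D0; apply: dderivp_mul_eq0.
  by apply: etrans (meval_XDC p) (etrans _ (esym (meval_XDC q))); rewrite epq.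
apply: etrans (congr2 +%R (dderivpXDC p) (dderivpXDC q)) _.
by rewrite -polyCD D0.
Qed.

End DirectionalDerivative.

(** By the Leibniz rule, a direction enters only through the derivatives of the factors. This allows
    [v] to be replaced by a simpler direction. *)
Lemma eq_dderiv_prod (R : comNzRingType) (N : nat) (k v w : 'rV[R]_N)
    (I : finType) (S : pred I) (F : I -> {mpoly R[N]}) :
  (forall i, S i -> dderiv k v (F i) = dderiv k w (F i)) ->
  dderiv k v (\prod_(i | S i) F i) = dderiv k w (\prod_(i | S i) F i).
Proof.
move=> eF; elim/big_ind: _ => //; first by rewrite !dderiv1.
by move=> p q ep eq; rewrite !dderivM ep eq.
Qed.

Lemma dderiv0v (R : comNzRingType) (N : nat) (k : 'rV[R]_N) p :
  dderiv k 0 p = 0.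
Proof. by apply: big1 => i _; rewrite mxE mul0r. Qed.

Lemma rank_neqP (F : fieldType) (r s : nat) (J : 'M[F]_(r, s)) :
  reflect (exists2 v : 'rV_s, v != 0 & forall i, \sum_j v 0 j * J i j = 0)
          (\rank J != s).
Proof.
have E (v : 'rV_s) : (v *m J^T == 0) = [forall i, \sum_j v 0 j * J i j == 0].
  apply/eqP/forallP => [v0 i|v0].
    move/rowP: v0 => /(_ i); rewrite !mxE => v0i; rewrite -[X in _ == X]v0i.
    by apply/eqP/eq_bigr => j _; rewrite mxE.
  apply/rowP => i; rewrite !mxE -[RHS](eqP (v0 i)).
  by apply: eq_bigr => j _; rewrite mxE.
rewrite -mxrank_tr -[_ == s]/(row_free _) -kermx_eq0.
apply: (iffP rowV0Pn) => - [v].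
  move=> /sub_kermxP/eqP; rewrite E => /forallP v0 nz.
  by exists v => // i; apply/eqP.
move=> nz v0; exists v => //; apply/sub_kermxP/eqP; rewrite E.
by apply/forallP => i; rewrite v0.
Qed.

(** * Input-output equation of the cycle model and its singular directions *)

Section CycleModel.
Variables (R : realType) (m : nat) (l : 'I_m.+2).
Local Notation M := (cycle_model l).
Local Notation N := (nparams M).
Local Notation kcyc i := (kedge R M (ordS i) i).
Local Notation kt := (ktilde R l).
Local Notation kl := (kleak R M l).

Lemma in_cycle_edges (i j : 'I_m.+2) :
  ((i, j) \in cycle_edges m.+2) = (j == ordS i).
Proof.
apply/imsetP/eqP => [[x _ [-> ->]]|->] //.
by exists i.
Qed.

Lemma compartment1E : compartment1 m.+2 = [set 0].
Proof. by apply/setP => i; rewrite !inE. Qed.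

Lemma char_poly_mx_cycle :
  char_poly_mx (compartmental_mx R M) =
  cyclic_mx (fun i => 'X + (kt i)%:P) (fun i => - (kcyc i)%:P).
Proof.
apply/matrixP => i j; rewrite !mxE in_cycle_edges.
case: (eqVneq i j) => [_|_] /=; last first.
  rewrite mulr0n add0r; case: eqP => [->|] //.
  by rewrite polyC0 oppr0.
rewrite mulr1n (big_pred1 (ordS i)) => [|p]; last first.
  by rewrite in_cycle_edges.
rewrite inE -opprD polyCN opprK /ktilde; congr (_ + _%:P).
by case: eqP => // _; rewrite addr0.
Qed.

Lemma io_coef_u_cycle :
  io_coef_u R M 0 0 = \prod_(i < m.+2 | (0 < i)%N) ('X + (kt i)%:P).
Proof. by rewrite /io_coef_u char_poly_mx_cycle cofactor_cyclic_mx00. Qed.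

Lemma io_coef_y_cycle :
  io_coef_y R M =
  ('X + (kt 0)%:P) * io_coef_u R M 0 0 - (\prod_i kcyc i)%:P.
Proof.
rewrite /io_coef_y char_poly_mx_cycle det_cyclic_mx io_coef_u_cycle.
(* The sign (-1)^(m+1) of the determinant formula and the m+2 signs of the entries [- kcyc i]
   combine to -1. *)
rewrite prodrN card_ord mulrA -exprD addnS exprS addnn -mul2n exprM sqrrN.
rewrite !expr1n mulr1 mulN1r rmorph_prod; congr (_ - _).
by rewrite (bigD1 0) //=; congr (_ * _); apply: eq_bigl => i; rewrite lt0n.
Qed.

Lemma singular_cycleP (k : 'rV[R]_N) :
  reflect (exists2 v : 'rV_N, v != 0 &
             dderivp k v (io_coef_u R M 0 0) = 0 /\
             dderivp k v (io_coef_y R M) = 0)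
          (k \in singular_locus R M).
Proof.
have cE : coefficient_map R M =
    (io_coef_y R M : seq _) ++ (io_coef_u R M 0 0 : seq _).
  by rewrite /coefficient_map /= !compartment1E !enum_set1 /= !cats0.
rewrite inE; apply: (iffP (rank_neqP _)) => - [v nz v0]; exists v => //.
  have D0 p : p \in coefficient_map R M -> dderiv k v p = 0.
    move=> p_in.
    have lt_p : (index p (coefficient_map R M) < size (coefficient_map R M))%N.
      by rewrite index_mem.
    rewrite -(v0 (Ordinal lt_p)); apply: eq_bigr => q _.
    by rewrite mxE /= nth_index.
  have Dp0 (P : {poly {mpoly R[N]}}) :
      {subset (P : seq _) <= coefficient_map R M} -> dderivp k v P = 0.
    move=> sP; apply/polyP => i; rewrite coef_dderivp coef0.
    case: (ltnP i (size P)) => [lt_i|ge_i]; first by apply/D0/sP/mem_nth.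
    by rewrite nth_default // raddf0.
  by split; apply: Dp0 => p p_in; rewrite cE mem_cat p_in ?orbT.
move=> r; under eq_bigr do rewrite mxE.
(* The bound on [r] can be forgotten, since [nth] returns 0 past the end. *)
rewrite -/(dderiv k v _); move: (nat_of_ord r) => {}r.
case: v0 => u0 y0; rewrite cE nth_cat; case: ifP => _.
  by rewrite -coef_dderivp y0 coef0.
by rewrite -coef_dderivp u0 coef0.
Qed.

(** * Directions described by the rates of change of the parameters *)

Lemma dderiv_kcyc (k v : 'rV[R]_N) (r : 'I_#|edges M|) i :
  enum_val r = (i, ordS i) -> dderiv k v (kcyc i) = v 0 (lshift _ r).
Proof.
move=> ri; rewrite /kedge (big_pred1 r) ?dderivX // => s.
by rewrite -ri (inj_eq enum_val_inj).
Qed.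

Lemma dderiv_kleak (k v : 'rV[R]_N) (r : 'I_#|leaks M|) :
  dderiv k v kl = v 0 (rshift _ r).
Proof.
have E (s : 'I_#|leaks M|) : enum_val s = l.
  by apply/set1P; have := enum_valP s.
rewrite /kleak (big_pred1 r) ?dderivX // => s.
by rewrite -[X in _ == X](E r) (inj_eq enum_val_inj).
Qed.

Lemma cycle_edge_val (r : 'I_#|edges M|) :
  enum_val r = ((enum_val r).1, ordS (enum_val r).1).
Proof.
have := enum_valP r; case: (enum_val r) => i j.
by rewrite in_cycle_edges => /eqP ->.
Qed.

(** Edges of the cycle are indexed by their sources, so [a] and [b] prescribe each coordinate of [v]
    exactly once. *)
Lemma direction_exists (k : 'rV[R]_N) (a : 'I_m.+2 -> R) (b : R) :
  exists2 v : 'rV[R]_N,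
    forall i, dderiv k v (kcyc i) = a i & dderiv k v kl = b.
Proof.
exists (\row_q match split q with inl r => a (enum_val r).1 | inr _ => b end).
  move=> i; have ei : (i, ordS i) \in edges M by rewrite in_cycle_edges.
  have ri := enum_rankK_in ei ei.
  by rewrite (dderiv_kcyc k _ ri) mxE (unsplitK (inl _)) ri.
have el : l \in leaks M by rewrite inE.
by rewrite (dderiv_kleak k _ (enum_rank_in el l)) mxE (unsplitK (inr _)).
Qed.

Lemma direction_eq0 (k v : 'rV[R]_N) :
  (forall i, dderiv k v (kcyc i) = 0) -> dderiv k v kl = 0 -> v = 0.
Proof.
move=> k0 l0; apply/rowP => q; rewrite mxE -(splitK q).
case: (split q) => r /=.
  by rewrite -(dderiv_kcyc k v (cycle_edge_val r)) k0.
by rewrite -(dderiv_kleak k v r) l0.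
Qed.

Lemma dderiv_ktilde (k v : 'rV[R]_N) i :
  dderiv k v (kt i) =
  dderiv k v (kcyc i) + (if i == l then dderiv k v kl else 0).
Proof.
by rewrite /ktilde; case: eqP => [->|_]; rewrite ?raddfD ?addr0.
Qed.

(** * Stationarity of the two input-output polynomials *)

Lemma dderivp_io_coef_y (k v : 'rV[R]_N) :
  dderivp k v (io_coef_u R M 0 0) = 0 ->
  dderivp k v (io_coef_y R M) = 0 <->
  dderiv k v (kt 0) = 0 /\ dderiv k v (\prod_i kcyc i) = 0.
Proof.
move=> u0; rewrite io_coef_y_cycle dderivpB dderivpM u0 mulr0 addr0.
rewrite dderivpXDC dderivpC; split=> [y0|[-> ->]]; last first.
  by rewrite polyC0 mul0r subr0.
have t0 : dderiv k v (kt 0) = 0.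
  pose Q := \prod_(i < m.+1) ('X - (- (kt (lift 0 i)).@[k 0])%:P).
  have EQ : map_poly (meval (k 0)) (io_coef_u R M 0 0) = Q.
    rewrite io_coef_u_cycle meval_prodXDC big_mkcond big_ord_recl /= mul1r.
    by apply: eq_bigr => i _; rewrite polyCN opprK.
  have Q1 : Q`_m.+1 = 1.
    have /monicP : Q \is monic by apply: monic_prod_XsubC.
    rewrite /lead_coef size_prod_XsubC /index_enum /= -enumT.
    by rewrite size_enum_ord.
  (* In degree m+1 > 0 the monic [Q] has coefficient 1 and the constant term does not contribute. *)
  have := congr1 (fun P : {poly R} => P`_m.+1) y0.
  rewrite EQ coefB coefCM coefC coef0 /= subr0 Q1.
  by rewrite mulr1.
split=> //; move: y0; rewrite t0 polyC0 mul0r sub0r => /eqP.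
by rewrite oppr_eq0 polyC_eq0 => /eqP.
Qed.

Lemma dderivp_io_coef_u_inj (k v : 'rV[R]_N) (i : 'I_m.+2) :
  (0 < i)%N ->
  (forall j : 'I_m.+2, (0 < j)%N -> j != i -> (kt j).@[k 0] != (kt i).@[k 0]) ->
  dderivp k v (io_coef_u R M 0 0) = 0 -> dderiv k v (kt i) = 0.
Proof.
move=> i_gt0 t_inj; rewrite io_coef_u_cycle (bigD1 i) //= dderivpM dderivpXDC.
move/(congr1 (fun P : {poly R} => P.[- (kt i).@[k 0]])).
(* The Leibniz term that keeps the factor ['X + kt i] vanishes at this point; the other is the
   wanted derivative times a product of differences, nonzero by [t_inj]. *)
rewrite meval_XDC /= !hornerE addNr mul0r addr0.
rewrite meval_prodXDC horner_prod => /eqP; rewrite mulf_eq0 => /orP[/eqP //|].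
rewrite prodf_seq_eq0 => /hasP[j _ /andP[/andP[j_gt0 ji]]].
by rewrite !hornerE addrC subr_eq0 (negPf (t_inj j j_gt0 ji)).
Qed.

(** * The two sources of singularity, and the converse *)

(** Raising the edge parameter out of [l] and lowering the leak equally fixes every modified rate;
    the full cycle product then changes at the rate assumed to be 0. *)
Lemma leak_direction_singular (k : 'rV[R]_N) :
  \prod_(i < m.+2 | i != l) (kcyc i).@[k 0] = 0 -> k \in singular_locus R M.
Proof.
move=> k0.
have [v vk vl] := direction_exists k (fun i => if i == l then 1 else 0) (-1).
apply/singular_cycleP; exists v.
  apply/eqP => v0; move/eqP: vl; rewrite v0 dderiv0v.
  by rewrite eq_sym oppr_eq0 oner_eq0.
have t0 i : dderiv k v (kt i) = 0.
  by rewrite dderiv_ktilde vk vl; case: eqP; rewrite ?subrr ?addr0.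
have u0 : dderivp k v (io_coef_u R M 0 0) = 0.
  rewrite io_coef_u_cycle; apply: dderivp_prod_eq0 => i _.
  by rewrite dderivpXDC t0.
split=> //; apply/dderivp_io_coef_y => //; split=> //.
rewrite (bigD1 l) //= dderivM vk eqxx mul1r rmorph_prod /= k0 add0r.
rewrite (eq_dderiv_prod (w := 0)) ?dderiv0v ?mulr0 // => i il.
by rewrite vk (negPf il) dderiv0v.
Qed.

Lemma collision_singular (k : 'rV[R]_N) (i j : 'I_m.+2) :
  \prod_(i < m.+2 | i != l) (kcyc i).@[k 0] != 0 ->
  (0 < i)%N -> (i < j)%N -> (kt i).@[k 0] = (kt j).@[k 0] ->
  k \in singular_locus R M.
Proof.
move=> nz i_gt0 lt_ij tij.
have ij : (i == j) = false by rewrite -val_eqE ltn_eqF.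
have ji : (j == i) = false by rewrite eq_sym.
pose a (h : 'I_m.+2) : R := (h == i)%:R - (h == j)%:R.
pose K := \prod_(h < m.+2 | h != l) kcyc h.
(* [w] gives the derivative of [K] before [v] is known: both directions will agree on the edges out
   of vertices other than [l]. *)
have [w wk _] := direction_exists k a 0.
(* [x] solves x K(k) + k_l D_w K = 0, with k_l the value of [kcyc l]; the leak rate [a l - x] below
   then restores the rate [a l] for [kt l]. *)
pose x := - ((kcyc l).@[k 0] * dderiv k w K) /
  \prod_(h < m.+2 | h != l) (kcyc h).@[k 0].
have [v vk vl] :=
  direction_exists k (fun h => if h == l then x else a h) (a l - x).
have vt h : dderiv k v (kt h) = a h.
  rewrite dderiv_ktilde vk vl; case: eqP => [->|_]; last by rewrite addr0.
  by rewrite addrC subrK.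
apply/singular_cycleP; exists v.
  apply/eqP => v0; move/eqP: (vt i); rewrite v0 dderiv0v /a eqxx ij.
  by rewrite subr0 eq_sym oner_eq0.
have u0 : dderivp k v (io_coef_u R M 0 0) = 0.
  rewrite io_coef_u_cycle (bigD1 i) //= (bigD1 j) /=; last first.
    by rewrite ji (ltn_trans i_gt0).
  (* The factors for [i] and [j] agree at [k] and have opposite derivatives, so their product is
     stationary; all other factors are stationary themselves. *)
  rewrite mulrA dderivpM [X in _ + _ * X]dderivp_prod_eq0 ?mulr0 ?addr0 => [|h].
    rewrite dderivp_mulXDC_eq0 ?mul0r // (vt i) (vt j) /a !eqxx ij ji.
    by rewrite subr0 sub0r subrr.
  move=> /andP[/andP[_ hi] hj].
  by rewrite dderivpXDC vt /a (negPf hi) (negPf hj) subrr.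
split=> //; apply/dderivp_io_coef_y => //; split.
  by rewrite vt /a -!val_eqE /= !ltn_eqF ?subrr // (ltn_trans i_gt0).
have DK : dderiv k v K = dderiv k w K.
  by apply: eq_dderiv_prod => h hl; rewrite vk wk (negPf hl).
by rewrite (bigD1 l) //= -/K dderivM vk eqxx rmorph_prod /= divfK // DK addNr.
Qed.

Lemma singular_cycle_model (k : 'rV[R]_N) :
  k \in singular_locus R M ->
  \prod_(i < m.+2 | i != l) (kcyc i).@[k 0] != 0 ->
  exists i j : 'I_m.+2,
    [/\ (0 < i)%N, (i < j)%N & (kt i).@[k 0] = (kt j).@[k 0]].
Proof.
move=> /singular_cycleP[v nz [u0 /dderivp_io_coef_y - /(_ u0) [t0 K0]]] k0.
case: (pickP [pred p : 'I_m.+2 * 'I_m.+2 | [&& (0 < p.1)%N, (p.1 < p.2)%N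
    & (kt p.1).@[k 0] == (kt p.2).@[k 0]]]) => [[i j] /= /and3P[? ? /eqP]|inj].
  by exists i, j.
have tne (i j : 'I_m.+2) :
    (0 < i)%N -> (i < j)%N -> (kt i).@[k 0] != (kt j).@[k 0].
  by move=> i0 ij; have := inj (i, j); rewrite /= i0 ij /= => ->.
(* Index 0 does not occur in the input polynomial; its derivative vanishes by [t0]. *)
have t_eq0 i : dderiv k v (kt i) = 0.
  case: (posnP i) => [/eqP i0|i_gt0].
    by have -> : i = 0 by apply/eqP.
  apply: dderivp_io_coef_u_inj u0 => // j j_gt0 ji.
  move: ji; rewrite -val_eqE /= neq_ltn => /orP[lt_ji|lt_ij]; first exact: tne.
  by rewrite eq_sym tne.
have k_eq0 i : i != l -> dderiv k v (kcyc i) = 0.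
  by move=> il; have := t_eq0 i; rewrite dderiv_ktilde (negPf il) addr0.
have l0 : dderiv k v (kcyc l) = 0.
  move: K0; rewrite (bigD1 l) //= dderivM rmorph_prod /=.
  (* The other edge parameters are stationary, so only the derivative of [kcyc l] times the nonzero
     product remains. *)
  rewrite (eq_dderiv_prod (w := 0)) ?dderiv0v ?mulr0 ?addr0 => [/eqP|i il].
    by rewrite mulf_eq0 (negPf k0) orbF => /eqP.
  by rewrite k_eq0 // dderiv0v.
case/eqP: nz; apply: (@direction_eq0 k) => [i|].
  by case: (eqVneq i l) => [->|/k_eq0].
by have := t_eq0 l; rewrite dderiv_ktilde eqxx l0 add0r.
Qed.

End CycleModel.

Theorem theorem4p5 (R : realType) (n : nat) (n_ge3 : (3 <= n)%N) (l : 'I_n) :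
  singular_locus R (cycle_model l) =i
  zero_set
    ((\prod_(i < n | i != l) kedge R (cycle_model l) (ordS i) i) *
     \prod_(i < n | (0 < i)%N) \prod_(j < n | (i < j)%N)
        (ktilde R l i - ktilde R l j)).
Proof.
case: n n_ge3 l => [|[|m]] // _ l k.
rewrite [RHS]inE rmorphM mulf_eq0 !rmorph_prod /=.
apply/idP/orP => [sk|[/eqP k0|]]; last 2 first.
- exact: leak_direction_singular k0.
- rewrite prodf_seq_eq0 => /hasP[i _ /andP[i_gt0]].
  rewrite rmorph_prod prodf_seq_eq0 => /hasP[j _ /andP[lt_ij]].
  rewrite rmorphB subr_eq0 => /eqP tij.
  (* The collision argument divides by this product, so its vanishing is treated separately. *)
  case: (eqVneq (\prod_(i < m.+2 | i != l)
                   (kedge R (cycle_model l) (ordS i) i).@[k 0]) 0) => k0.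
    exact: leak_direction_singular k0.
  exact: collision_singular k0 i_gt0 lt_ij tij.
case: eqVneq => k0; [by left | right].
have [i [j [i_gt0 lt_ij tij]]] := singular_cycle_model sk k0.
rewrite (bigD1 i) //= rmorph_prod (bigD1 j) //= rmorphB /= tij subrr.
by rewrite !mul0r.
Qed.
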